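(* Let $\mathcal{R}$ be a right-stable DCTRS such that $\mathbb{U}_{seq}(\mathcal{R})$ is confluent and terminating. Then $\mathbb{U}_{seq}$ is sound for reductions to normal forms: for all $u, v \in \mathcal{T}$ such that $u \rightarrow^*_{\mathbb{U}_{seq}(\mathcal{R})} v$ and $v$ is a normal form w.r.t. $\mathbb{U}_{seq}(\mathcal{R})$, we have $u \rightarrow^*_{\mathcal{R}} v$.
   Context: Terms $\mathcal{T}=\mathcal{T}(\mathcal{F},\mathcal{V})$ over a signature $\mathcal{F}$ and a countably infinite set of variables $\mathcal{V}$. An (oriented) conditional rule has the form $l \rightarrow r \Leftarrow s_1 \rightarrow^* t_1, \ldots, s_k \rightarrow^* t_k$ ($k\ge 0$). It is deterministic if $\mathcal{V}ar(r) \subseteq \mathcal{V}ar(l) \cup \mathcal{V}ar(s_1,t_1,\ldots,s_k,t_k)$ and $\mathcal{V}ar(s_i) \subseteq \mathcal{V}ar(l, t_1, \ldots, t_{i-1})$ for all $i$. A DCTRS $\mathcal{R}$ is a set of such rules; $\mathcal{R}_u=\{l\rightarrow r \mid l \rightarrow r \Leftarrow c \in \mathcal{R}\}$. Rewrite relation: $\mathcal{R}_0=\emptyset$, $\mathcal{R}_{n+1}=\{l\sigma \rightarrow r\sigma \mid l \rightarrow r \Leftarrow s_1 \rightarrow^* t_1,\ldots \in \mathcal{R},\ s_j\sigma \rightarrow^*_{\mathcal{R}_n} t_j\sigma \text{ for all } j\}$, $\rightarrow_{\mathcal{R}}=\bigcup_n \rightarrow_{\mathcal{R}_n}$. $\mathcal{R}$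 is right-stable if for every rule and every $i$, $t_i$ is either a linear constructor term (no root symbol of a left-hand side of $\mathcal{R}$ occurs in it) or a ground term irreducible w.r.t. $\mathcal{R}_u$, and $\mathcal{V}ar(t_i) \cap \mathcal{V}ar(l, s_1, t_1, \ldots, s_{i-1}, t_{i-1}, s_i) = \emptyset$. Sequential unraveling: for $\alpha: l \rightarrow r \Leftarrow s_1 \rightarrow^* t_1, \ldots, s_k \rightarrow^* t_k$ with $k\ge1$, let $X_i=\mathcal{V}ar(l,t_1,\ldots,t_{i-1})$ with fixed ordering $\vec{X_i}$, fresh symbols $U^\alpha_1,\dots,U^\alpha_k$, and $\mathbb{U}_{seq}(\alpha)=\{l \rightarrow U^\alpha_1(s_1,\vec{X_1})\}\cup\{U^\alpha_i(t_i,\vec{X_i}) \rightarrow U^\alpha_{i+1}(s_{i+1},\vec{X_{i+1}}) \mid 1\le i<k\}\cup\{U^\alpha_k(t_k,\vec{X_k}) \rightarrow r\}$; unconditional rules are kept unchanged. $\mathbb{U}_{seq}(\mathcal{R})=\bigcup_{\alpha}\mathbb{U}_{seq}(\alpha)$. *)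

(* Defs.v *)
From mathcomp Require Import all_boot.
From mathcomp Require Import boolp classical_sets.
From Stdlib Require Import Relation_Operators.

Set Implicit Arguments.
Unset Strict Implicit.
Unset Printing Implicit Defensive.

(* The countably infinite set of variables is [nat]. *)

Inductive term (F : Type) (ar : F -> nat) : Type :=
  | Var of nat
  | Fun (f : F) of {ffun 'I_(ar f) -> term ar}.

Arguments Var {F ar} x.
Arguments Fun {F ar} f a.

Section Terms.

Variables (F : Type) (ar : F -> nat).
Implicit Types (t : term ar) (f g : F).

(* With repetitions, so that linearity is [uniq (vars t)]. *)
Fixpoint vars t : seq nat :=
  match t with
  | Var x => [:: x]
  | Fun f a => flatten [seq vars (a i) | i <- enum 'I_(ar f)]
  end.

Fixpoint occurs g t : Prop :=
  match t with
  | Var _ => False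
  | Fun f a => f = g \/ exists i, occurs g (a i)
  end.

Fixpoint subst (sigma : nat -> term ar) t : term ar :=
  match t with
  | Var x => sigma x
  | Fun f a => Fun f [ffun i => subst sigma (a i)]
  end.

Definition linear t : Prop := uniq (vars t).

Definition ground t : Prop := vars t = [::].

End Terms.

Section Reductions.

Variables (T : Type) (step : T -> T -> Prop).

Definition confluent : Prop := forall s t1 t2 : T,
  clos_refl_trans T step s t1 -> clos_refl_trans T step s t2 ->
  exists t, clos_refl_trans T step t1 t /\ clos_refl_trans T step t2 t.

Definition terminating : Prop :=
  ~ exists s : nat -> T, forall n, step (s n) (s n.+1).

Definition normal_form (t : T) : Prop := ~ exists t', step t t'.

End Reductions.

Section Rewriting.

Variables (F : Type) (ar : F -> nat).

(* A set of unconditional rules. *)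
Definition trs := term ar -> term ar -> Prop.

Inductive rstep (S : trs) : term ar -> term ar -> Prop :=
  | rstep_root (sigma : nat -> term ar) (l r : term ar) :
      S l r -> rstep S (subst sigma l) (subst sigma r)
  | rstep_arg (f : F) (a : {ffun 'I_(ar f) -> term ar}) (i : 'I_(ar f))
      (t : term ar) :
      rstep S (a i) t ->
      rstep S (Fun f a) (Fun f [ffun j => if j == i then t else a j]).

(* [conds] lists the pairs [(s_1, t_1); ...; (s_k, t_k)]. *)
Record rule := Rule {
  lhs : term ar;
  rhs : term ar;
  conds : seq (term ar * term ar)
}.

(* Conditions are numbered from 0, so [cond_s alpha i] is s_(i+1). *)
Definition cond_s (alpha : rule) (i : nat) : term ar :=
  (nth (Var 0, Var 0) (conds alpha) i).1.
Definition cond_t (alpha : rule) (i : nat) : term ar :=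
  (nth (Var 0, Var 0) (conds alpha) i).2.

(* Var(l, t_1, ..., t_i): with 0-based numbering, the variables available     *)
(* before evaluating condition [i].                                           *)
Definition prefix_vars (alpha : rule) (i : nat) : seq nat :=
  vars (lhs alpha) ++ flatten [seq vars c.2 | c <- take i (conds alpha)].

(* Var(l, s_1, t_1, ..., s_i, t_i). *)
Definition full_prefix_vars (alpha : rule) (i : nat) : seq nat :=
  vars (lhs alpha) ++
  flatten [seq vars c.1 ++ vars c.2 | c <- take i (conds alpha)].

Definition deterministic (alpha : rule) : Prop :=
  {subset vars (rhs alpha) <= full_prefix_vars alpha (size (conds alpha))} /\
  forall i, i < size (conds alpha) ->
    {subset vars (cond_s alpha i) <= prefix_vars alpha i}.

Definition DCTRS (R : set rule) : Prop :=
  forall alpha, R alpha -> deterministic alpha.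

Definition underlying (R : set rule) : trs := fun l r =>
  exists alpha, [/\ R alpha, lhs alpha = l & rhs alpha = r].

Fixpoint level (R : set rule) (n : nat) : trs :=
  match n with
  | 0 => fun _ _ => False
  | m.+1 => fun u v => exists (alpha : rule) (sigma : nat -> term ar),
      [/\ R alpha,
          u = subst sigma (lhs alpha),
          v = subst sigma (rhs alpha)
        & forall i, i < size (conds alpha) ->
            clos_refl_trans (term ar) (rstep (level R m))
              (subst sigma (cond_s alpha i)) (subst sigma (cond_t alpha i))]
  end.

Definition cstep (R : set rule) (u v : term ar) : Prop :=
  exists n, rstep (level R n) u v.

Definition constructor_term (R : set rule) (t : term ar) : Prop :=
  forall (alpha : rule) (f : F) (a : {ffun 'I_(ar f) -> term ar}),
    R alpha -> lhs alpha = Fun f a -> ~ occurs f t.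

Definition right_stable (R : set rule) : Prop :=
  forall alpha, R alpha -> forall i, i < size (conds alpha) ->
    ((linear (cond_t alpha i) /\ constructor_term R (cond_t alpha i)) \/
     (ground (cond_t alpha i) /\
      normal_form (rstep (underlying R)) (cond_t alpha i))) /\
    (forall x, x \in vars (cond_t alpha i) ->
       x \notin full_prefix_vars alpha i ++ vars (cond_s alpha i)).

End Rewriting.

Section Unraveling.

Variables (F : Type) (ar : F -> nat) (R : set (rule ar)).

(* The fresh symbols U^alpha_i: exactly one for each rule alpha of [R] and    *)
(* each condition of alpha.  [R] is used as the type of its elements, whose   *)
(* membership proofs are boolean, hence irrelevant.                           *)
Definition usym : Type := {alpha : R & 'I_(size (conds (val alpha)))}.

(* [X u] is the ordered list of variables carried by the symbol [u]. *)
Variable X : usym -> seq nat.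

Definition is_ordering : Prop := forall (alpha : R) i,
  uniq (X (existT _ alpha i)) /\
  X (existT _ alpha i) =i prefix_vars (val alpha) i.

Definition uar (g : F + usym) : nat :=
  match g with
  | inl f => ar f
  | inr u => (size (X u)).+1
  end.

Fixpoint lift_term (t : term ar) : term uar :=
  match t with
  | Var x => Var x
  | Fun f a => @Fun _ uar (inl f) [ffun i => lift_term (a i)]
  end.

Definition uterm (alpha : R) (i : 'I_(size (conds (val alpha))))
    (t : term ar) : term uar :=
  let u : usym := existT _ alpha i in
  @Fun _ uar (inr u)
    [ffun j : 'I_(size (X u)).+1 =>
       nth (Var 0) (lift_term t :: [seq Var x | x <- X u]) j].

Inductive Useq : trs uar :=
  | Useq_uncond (alpha : R) :
      conds (val alpha) = [::] ->
      Useq (lift_term (lhs (val alpha))) (lift_term (rhs (val alpha)))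
  | Useq_first (alpha : R) (i : 'I_(size (conds (val alpha)))) :
      i = 0 :> nat ->
      Useq (lift_term (lhs (val alpha))) (uterm i (cond_s (val alpha) i))
  | Useq_next (alpha : R) (i j : 'I_(size (conds (val alpha)))) :
      j = i.+1 :> nat ->
      Useq (uterm i (cond_t (val alpha) i)) (uterm j (cond_s (val alpha) j))
  | Useq_last (alpha : R) (i : 'I_(size (conds (val alpha)))) :
      i.+1 = size (conds (val alpha)) ->
      Useq (uterm i (cond_t (val alpha) i)) (lift_term (rhs (val alpha))).

End Unraveling.

Arguments Useq {F ar R} X _ _.
Arguments lift_term {F ar R} X t.

(* Main.v *)
Require Import Defs.
From mathcomp Require Import all_boot.
From mathcomp Require Import boolp classical_sets.
From Stdlib Require Import Relation_Operators.

Set Implicit Arguments.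
Unset Strict Implicit.
Unset Printing Implicit Defensive.

(* As the unraveled system is confluent and terminating, the normal form of   *)
(* [u] may be computed innermost.  Translate terms back by replacing each     *)
(* U^alpha_i(w, xs) by the instance of the left-hand side of alpha from which *)
(* it originates.  In an innermost reduction the bindings xs are normal       *)
(* forms and never change, so one can maintain the invariant that below every *)
(* U^alpha_i(w, xs) the conditions before the i-th hold for the translated    *)
(* bindings and s_i reduces in R to the translation of w.  Every innermost    *)
(* step then translates to at most one step of R.                             *)

(** A U-symbol marks a conditional rule whose conditions are still being evaluated; [back] cancels
    this pending application, and [good] says that everything evaluated so far is justified in R.
    Under [good], opening a rule or passing to its next condition does not change the [back] image,
    while closing it is one genuine R-step, whose premises are exactly the recorded reductions
    ([good_root_step]). The invariant survives only suitable reductions, so [good_progress] shows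
    that each reducible good term has at least one step keeping it, obtained at an innermost redex.
    By termination such steps lead from the lifted [u] to some normal form ([terminating_progress]),
    and by confluence this is the lifted [v], whose [back] image is [v] ([lift_termK]). *)

Local Notation rtc := (clos_refl_trans _).

(** * Abstract reduction: closures and normal forms *)

Section Closures.

Variables (T T' : Type).

Lemma rtc_homo (r : T -> T -> Prop) (r' : T' -> T' -> Prop) (h : T -> T') :
  (forall x y, r x y -> r' (h x) (h y)) ->
  forall x y, rtc r x y -> rtc r' (h x) (h y).
Proof.
move=> hr x y; elim=> [{}x {}y /hr|{}x|{}x {}y z _ IH1 _ IH2].
- exact: rt_step.
- exact: rt_refl.
- exact: rt_trans IH1 IH2.
Qed.

Lemma normal_form_rtc (r : T -> T -> Prop) x y :
  normal_form r x -> rtc r x y -> y = x.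
Proof.
move=> nfx xy; elim: xy nfx => [{}x {}y xy nfx|//|{}x {}y z _ IH1 _ IH2 nfx].
- by case: nfx; exists y.
- by have eyx := IH1 nfx; rewrite eyx in IH2; apply: IH2.
Qed.

(** Only one well-chosen step per term has to preserve [P], so a strategy can be fixed. If no normal
    form satisfying [P] were reachable, choice would iterate these steps forever. *)
Lemma terminating_progress (r : T -> T -> Prop) (P : T -> Prop) x :
  terminating r ->
  (forall y, P y -> ~ normal_form r y -> exists2 z, r y z & P z) ->
  P x -> exists2 y, P y & rtc r x y /\ normal_form r y.
Proof.
move=> tr step Px; apply: contrapT => noNF; apply: tr.
pose Q := {y | P y /\ rtc r x y}.
have next (q : Q) : {q' : Q | r (sval q) (sval q')}.
  case: q => y [Py xy]; apply: cid.
  have [|z yz Pz] := step y Py.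
    by move=> nfy; apply: noNF; exists y.
  by exists (exist _ z (conj Pz (rt_trans _ _ _ _ _ xy (rt_step _ _ _ _ yz)))).
pose q0 : Q := exist _ x (conj Px (rt_refl _ _ _)).
exists (fun n => sval (iter n (fun q => sval (next q)) q0)) => n.
exact: svalP (next _).
Qed.

End Closures.

(** * Terms, substitutions and normal instances *)

Section Terms.

Variables (F : Type) (ar : F -> nat).
Implicit Types (t : term ar) (sigma : nat -> term ar).

Lemma term_nested_ind (P : term ar -> Prop) :
  (forall x, P (Var x)) ->
  (forall f (a : {ffun 'I_(ar f) -> term ar}),
     (forall i, P (a i)) -> P (Fun f a)) ->
  forall t, P t.
Proof.
move=> PV PF; fix IH 1; case=> [x|f a]; first exact: PV.
by apply: PF => i; apply: IH.
Qed.

Lemma vars_arg f (a : {ffun 'I_(ar f) -> term ar}) i :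
  {subset vars (a i) <= vars (Fun f a)}.
Proof.
move=> x xi /=; apply/flatten_mapP; exists i => //; exact: mem_enum.
Qed.

Lemma vars_FunP f (a : {ffun 'I_(ar f) -> term ar}) x :
  x \in vars (Fun f a) -> exists i, x \in vars (a i).
Proof. by case/flatten_mapP=> i _; exists i. Qed.

Lemma eq_in_subst sigma tau t :
  {in vars t, sigma =1 tau} -> subst sigma t = subst tau t.
Proof.
elim/term_nested_ind: t => [x|f a IH] eqst /=; first by rewrite eqst ?inE.
congr Fun; apply/ffunP=> i; rewrite !ffunE; apply: IH => x xi.
exact/eqst/(vars_arg xi).
Qed.

Section NormalForms.

Variable S : trs ar.

Lemma rstep_root_or_arg t t' : rstep S t t' ->
  (exists sigma l r, [/\ S l r, t = subst sigma l & t' = subst sigma r]) \/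
  (exists f (a : {ffun 'I_(ar f) -> term ar}) i,
     t = Fun f a /\ ~ normal_form (rstep S) (a i)).
Proof.
case=> [sigma l r Slr|f a i s ais]; first by left; exists sigma, l, r.
by right; exists f, a, i; split=> //; apply; exists s.
Qed.

Lemma normal_form_arg f (a : {ffun 'I_(ar f) -> term ar}) i :
  normal_form (rstep S) (Fun f a) -> normal_form (rstep S) (a i).
Proof. by move=> nfa [t ait]; apply: nfa; eexists; apply: rstep_arg ait. Qed.

Lemma normal_form_subst sigma t x :
  normal_form (rstep S) (subst sigma t) -> x \in vars t ->
  normal_form (rstep S) (sigma x).
Proof.
elim/term_nested_ind: t => [y|f a IH] /=.
  by move=> nf; rewrite inE => /eqP->.
move=> nfa /vars_FunP[i]; apply: IH.
by have := normal_form_arg (i := i) nfa; rewrite ffunE.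
Qed.

Definition args_normal t : Prop :=
  match t with
  | Var _ => True
  | Fun _ a => forall i, normal_form (rstep S) (a i)
  end.

Lemma rstep_args_normal t t' : args_normal t -> rstep S t t' ->
  exists sigma l r, [/\ S l r, t = subst sigma l & t' = subst sigma r].
Proof.
move=> nft /rstep_root_or_arg[//|[f [a [i [eqt []]]]]].
by rewrite eqt in nft; apply: nft.
Qed.

(** In a non-variable pattern every variable sits inside a proper argument; this is how an innermost
    match yields normal bindings. *)
Lemma args_normal_subst sigma t x :
  (forall y, t <> Var y) -> args_normal (subst sigma t) -> x \in vars t ->
  normal_form (rstep S) (sigma x).
Proof.
case: t => [y /(_ y)//|f a _ /= nfa /vars_FunP[i]].
by apply: normal_form_subst; have := nfa i; rewrite ffunE.
Qed.

End NormalForms.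

End Terms.

(** * Closure properties of the conditional rewrite relation *)

Section Levels.

Variables (F : Type) (ar : F -> nat) (R : set (rule ar)).

Lemma rstep_mono (S S' : trs ar) :
  (forall l r, S l r -> S' l r) -> forall s t, rstep S s t -> rstep S' s t.
Proof.
move=> sSS' s t; elim=> [sigma l r /sSS'|f a i {}t _].
- exact: rstep_root.
- exact: rstep_arg.
Qed.

Lemma level_mono n m : n <= m -> forall l r, level R n l r -> level R m l r.
Proof.
elim: n m => [|n IH] [|m] // lenm l r [alpha [sigma [Ra -> -> hc]]].
exists alpha, sigma; split=> // i /hc.
by apply: (rtc_homo (h := id)); apply: rstep_mono; apply: IH.
Qed.

Lemma rtc_level_mono n m s t : n <= m ->
  rtc (rstep (level R n)) s t -> rtc (rstep (level R m)) s t.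
Proof.
by move=> /level_mono lenm; apply: (rtc_homo (h := id)); apply: rstep_mono.
Qed.

Lemma rtc_cstep_level s t :
  rtc (cstep R) s t -> exists n, rtc (rstep (level R n)) s t.
Proof.
elim=> [{}s {}t [n st]|{}s|{}s {}t w _ [n st] _ [m tw]].
- by exists n; apply: rt_step.
- by exists 0; apply: rt_refl.
- exists (maxn n m); apply: rt_trans.
    exact: rtc_level_mono (leq_maxl _ _) st.
  exact: rtc_level_mono (leq_maxr _ _) tw.
Qed.

Lemma cstep_arg f (a : {ffun 'I_(ar f) -> term ar}) i t :
  cstep R (a i) t ->
  cstep R (Fun f a) (Fun f [ffun j => if j == i then t else a j]).
Proof. by case=> n ait; exists n; apply: rstep_arg. Qed.

Lemma rtc_cstep_arg f (a : {ffun 'I_(ar f) -> term ar}) i t :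
  rtc (cstep R) (a i) t ->
  rtc (cstep R) (Fun f a) (Fun f [ffun j => if j == i then t else a j]).
Proof.
have -> : Fun f a = Fun f [ffun j => if j == i then a i else a j].
  by congr Fun; apply/ffunP=> j; rewrite ffunE; case: eqP => // ->.
pose h s : term ar := Fun f [ffun j => if j == i then s else a j].
apply: (rtc_homo (h := h)) => s s' ss'.
have -> : h s' = Fun f [ffun j => if j == i then s' else
                     [ffun j => if j == i then s else a j] j].
  by congr Fun; apply/ffunP=> j; rewrite !ffunE; case: (j == i).
by apply: cstep_arg; rewrite ffunE eqxx.
Qed.

(** There are finitely many conditions and levels are cumulative, so all of them hold at the maximum
    of their levels. *)
Lemma cstep_root alpha (sigma : nat -> term ar) : R alpha ->
  (forall i, i < size (conds alpha) ->
     rtc (cstep R) (subst sigma (cond_s alpha i))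
                   (subst sigma (cond_t alpha i))) ->
  cstep R (subst sigma (lhs alpha)) (subst sigma (rhs alpha)).
Proof.
move=> Ra hc.
pose k := size (conds alpha); rewrite -/k in hc.
have lvl (i : 'I_k) := cid (rtc_cstep_level (hc i (ltn_ord i))).
exists (\max_(i < k) sval (lvl i)).+1.
have lv : level R (\max_(i < k) sval (lvl i)).+1
            (subst sigma (lhs alpha)) (subst sigma (rhs alpha)).
  exists alpha, sigma; split=> // i ltik.
  by apply: rtc_level_mono (svalP (lvl (Ordinal ltik))); apply: leq_bigmax.
(* [level] already contains the instances of rules, so the substitution of [rstep] is taken to be
   the identity. *)
have := rstep_root (fun x => Var x) lv.
have subst_Var (t : term ar) : subst (fun x => Var x) t = t.
  elim/term_nested_ind: t => [//|f a IH] /=.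
  by congr Fun; apply/ffunP=> i; rewrite ffunE.
by rewrite !subst_Var.
Qed.

End Levels.

(** * Variables available before each condition *)

Section PrefixVars.

Variables (F : Type) (ar : F -> nat).
Implicit Type alpha : rule ar.

Lemma prefix_vars_lhs alpha i :
  {subset vars (lhs alpha) <= prefix_vars alpha i}.
Proof. by move=> x xl; rewrite mem_cat xl. Qed.

Lemma prefix_vars0 alpha : prefix_vars alpha 0 = vars (lhs alpha).
Proof. by rewrite /prefix_vars take0 cats0. Qed.

Lemma prefix_varsS alpha i : i < size (conds alpha) ->
  prefix_vars alpha i.+1 = prefix_vars alpha i ++ vars (cond_t alpha i).
Proof.
move=> lti; rewrite /prefix_vars (take_nth (Var 0, Var 0)) // map_rcons.
by rewrite flatten_rcons catA.
Qed.

Lemma prefix_vars_leq alpha i j : i <= j ->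
  {subset prefix_vars alpha i <= prefix_vars alpha j}.
Proof.
move=> leij x; rewrite !mem_cat => /orP[->//|xi]; apply/orP; right.
rewrite -(subnKC leij) takeD map_cat flatten_cat mem_cat.
by rewrite xi.
Qed.

Lemma cond_t_prefix alpha i j : i < j -> i < size (conds alpha) ->
  {subset vars (cond_t alpha i) <= prefix_vars alpha j}.
Proof.
move=> ltij lti x xt; apply: (prefix_vars_leq ltij).
by rewrite prefix_varsS // mem_cat xt orbT.
Qed.

Hypothesis (alpha : rule ar) (det : deterministic alpha).

Lemma cond_s_prefix i j : i <= j -> i < size (conds alpha) ->
  {subset vars (cond_s alpha i) <= prefix_vars alpha j}.
Proof. by move=> leij lti x /(det.2 _ lti); apply: prefix_vars_leq. Qed.

(** Determinism also lets the right-hand side use variables of the s_i, but these come from l and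
    earlier t_j, so the stored bindings and the last match suffice. *)
Lemma rhs_prefix :
  {subset vars (rhs alpha) <= prefix_vars alpha (size (conds alpha))}.
Proof.
move=> x /det.1; rewrite mem_cat => /orP[/prefix_vars_lhs//|].
rewrite take_size => /flattenP[xs /(nthP [::])[i]].
rewrite size_map => lti <-; rewrite (nth_map (Var 0, Var 0)) //.
rewrite mem_cat => /orP[]; first by apply: cond_s_prefix => //; apply: ltnW.
exact: cond_t_prefix.
Qed.

End PrefixVars.

(** * Back-translation and its invariant *)

Section Translation.

Variables (F : Type) (ar : F -> nat) (R : set (rule ar)).
Variable X : usym R -> seq nat.
Hypotheses (hX : is_ordering X) (hdet : DCTRS R).

Local Notation uterms := (term (uar X)).
Local Notation U := (rstep (Useq X)).
Implicit Types (u : usym R) (w : uterms) (sigma : nat -> uterms).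

Definition urule u : rule ar := val (tag u).
Definition upos u : nat := tagged u.

Lemma uruleP u : R (urule u).
Proof. exact: set_mem (valP (tag u)). Qed.

Lemma upos_lt u : upos u < size (conds (urule u)).
Proof. exact: ltn_ord. Qed.

Lemma mem_X u : X u =i prefix_vars (urule u) (upos u).
Proof. by case: u => alpha i; have [] := hX i. Qed.

(** The shift by one skips argument 0, which holds the term under evaluation. For [x] outside [X u],
    [inord] falls back to [ord0], a junk value. *)
Definition binding_pos u (x : nat) : 'I_(size (X u)).+1 :=
  inord (index x (X u)).+1.

Lemma binding_pos_val u x : x \in X u ->
  binding_pos u x = (index x (X u)).+1 :> nat.
Proof. by move=> xX; rewrite inordK // ltnS index_mem. Qed.

Definition back_node (g : F + usym R) :
    ('I_(uar X g) -> term ar) -> term ar :=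
  match g with
  | inl f => fun b => Fun f (finfun b)
  | inr u => fun b => subst (fun x => b (binding_pos u x)) (lhs (urule u))
  end.

Fixpoint back w : term ar :=
  match w with
  | Var x => Var x
  | Fun g a => back_node (fun i => back (a i))
  end.

(** Normality of the bindings freezes [tau], so the recorded reductions stay valid while argument 0
    is being rewritten. *)
Definition good_node (g : F + usym R) :
    ({ffun 'I_(uar X g) -> uterms}) -> Prop :=
  match g with
  | inl f => fun _ => True
  | inr u => fun a =>
      let tau x := back (a (binding_pos u x)) in
      [/\ forall i, i != ord0 -> normal_form U (a i),
          forall j, j < upos u ->
            rtc (cstep R) (subst tau (cond_s (urule u) j))
                          (subst tau (cond_t (urule u) j))
        & rtc (cstep R) (subst tau (cond_s (urule u) (upos u)))
                        (back (a ord0))]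
  end.

Fixpoint good w : Prop :=
  match w with
  | Var _ => True
  | Fun g a => (forall i, good (a i)) /\ good_node a
  end.

Lemma back_lift sigma (t : term ar) :
  back (subst sigma (lift_term X t)) = subst (back \o sigma) t.
Proof.
elim/term_nested_ind: t => [//|f a IH] /=.
by congr Fun; apply/ffunP=> i; rewrite !ffunE.
Qed.

Lemma vars_lift (t : term ar) : vars (lift_term X t) = vars t.
Proof.
elim/term_nested_ind: t => [//|f a IH] /=.
by congr flatten; apply: eq_map => i; rewrite ffunE.
Qed.

Lemma lift_Var (t : term ar) :
  (forall y, t <> Var y) -> forall y, lift_term X t <> Var y.
Proof. by case: t => // x /(_ x). Qed.

Lemma subst_Var_lift (t : term ar) :
  subst (fun x => Var x) (lift_term X t) = lift_term X t.
Proof.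
elim/term_nested_ind: t => [//|f a IH] /=.
by congr Fun; apply/ffunP=> i; rewrite !ffunE.
Qed.

Lemma lift_termK : cancel (lift_term X) back.
Proof.
move=> t; elim/term_nested_ind: t => [//|f a IH] /=.
by congr Fun; apply/ffunP=> i; rewrite !ffunE.
Qed.

Lemma good_subst_lift sigma (t : term ar) :
  good (subst sigma (lift_term X t)) <->
  (forall x, x \in vars t -> good (sigma x)).
Proof.
elim/term_nested_ind: t => [x|f a IH] /=.
  by split=> [gx y|]; [rewrite inE => /eqP-> | apply; rewrite inE].
split=> [ga x /flatten_mapP[i _]|gs].
  by apply: (IH i).1; case: ga => ga _; have := ga i; rewrite !ffunE.
by split=> // i; rewrite !ffunE; apply/(IH i) => x xi; apply/gs/(vars_arg xi).
Qed.

Lemma good_lift (t : term ar) : good (lift_term X t).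
Proof. by rewrite -subst_Var_lift; apply/good_subst_lift. Qed.

Definition uargs u w sigma : {ffun 'I_(uar X (inr u)) -> uterms} :=
  [ffun j : 'I_(size (X u)).+1 => nth (Var 0) (w :: map sigma (X u)) j].

Definition uapp u w sigma : uterms := @Fun _ (uar X) (inr u) (uargs u w sigma).

Lemma subst_uterm sigma (alpha : R) (i : 'I_(size (conds (val alpha)))) t :
  subst sigma (uterm X i t) =
  uapp (existT _ alpha i) (subst sigma (lift_term X t)) sigma.
Proof.
rewrite /uapp /uargs /=; congr Fun; apply/ffunP=> j; rewrite !ffunE.
case: j => [[|j] ltj] //=.
by rewrite (nth_map 0) // (nth_map 0).
Qed.

(** * Nodes headed by a U-symbol *)

Section Uapp.

Variables (u : usym R) (w : uterms) (sigma : nat -> uterms).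

Let a := uargs u w sigma.

Let a0 : a ord0 = w. Proof. by rewrite ffunE. Qed.

Let a_pos x : x \in X u -> a (binding_pos u x) = sigma x.
Proof.
move=> xX; rewrite ffunE binding_pos_val //=.
by rewrite (nth_map 0) ?index_mem // nth_index.
Qed.

Let a_cases i : i = ord0 \/ exists2 x, x \in X u & a i = sigma x.
Proof.
case: i => [[|i] lti]; [by left; apply: val_inj | right].
by exists (nth 0 (X u) i); [rewrite mem_nth | rewrite ffunE /= (nth_map 0)].
Qed.

Let subst_a (t : term ar) : {subset vars t <= X u} ->
  subst (fun x => back (a (binding_pos u x))) t = subst (back \o sigma) t.
Proof. by move=> sub; apply: eq_in_subst => x /sub/a_pos/= ->. Qed.

Lemma back_uapp :
  back (uapp u w sigma) = subst (back \o sigma) (lhs (urule u)).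
Proof.
by apply: subst_a => x; rewrite mem_X; apply: prefix_vars_lhs.
Qed.

(** Replaces argument positions by the matching substitution. By determinism all variables of the
    conditions involved lie in [X u], where the two agree. *)
Lemma good_uappP : good (uapp u w sigma) <->
  [/\ good w,
      forall x, x \in X u -> good (sigma x) /\ normal_form U (sigma x),
      forall j, j < upos u ->
        rtc (cstep R) (subst (back \o sigma) (cond_s (urule u) j))
                      (subst (back \o sigma) (cond_t (urule u) j))
    & rtc (cstep R) (subst (back \o sigma) (cond_s (urule u) (upos u)))
                    (back w)].
Proof.
have det := hdet (uruleP u).
have sX j : j <= upos u -> {subset vars (cond_s (urule u) j) <= X u}.
  move=> lej x xs; rewrite mem_X; apply: (cond_s_prefix det lej) => //.
  exact: leq_ltn_trans lej (upos_lt u).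
have tX j : j < upos u -> {subset vars (cond_t (urule u) j) <= X u}.
  move=> ltj x xt; rewrite mem_X; apply: (cond_t_prefix ltj) => //.
  exact: ltn_trans ltj (upos_lt u).
have goodE : good (uapp u w sigma) <-> (forall i, good (a i)) /\
    [/\ forall i, i != ord0 -> normal_form U (a i),
        forall j, j < upos u ->
          rtc (cstep R)
            (subst (fun x => back (a (binding_pos u x))) (cond_s (urule u) j))
            (subst (fun x => back (a (binding_pos u x))) (cond_t (urule u) j))
      & rtc (cstep R)
          (subst (fun x => back (a (binding_pos u x)))
             (cond_s (urule u) (upos u)))
          (back (a ord0))].
  by [].
rewrite goodE a0 subst_a; last exact: sX.
split=> [[ga [nfa hc hl]]|[gw gs hc hl]]; split=> //.
- by rewrite -a0.
- move=> x xX; rewrite -(a_pos xX); split=> //; apply: nfa.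
  by rewrite -val_eqE /= binding_pos_val.
- by move=> j ltj; have := hc j ltj; rewrite !subst_a //;
    [apply: tX|apply/sX/ltnW].
- by move=> i; have [->|[x xX ->]] := a_cases i; [rewrite a0 | case: (gs x xX)].
- split=> // [i|j ltj].
    by have [->|[x xX ->] _] := a_cases i; [rewrite eqxx | case: (gs x xX)].
  by rewrite !subst_a; [apply: hc|apply: tX|apply/sX/ltnW].
Qed.

Lemma uargs_set_ord0 w' :
  [ffun j => if j == ord0 then w' else a j] = uargs u w' sigma.
Proof. by apply/ffunP=> -[[|j] ltj]; rewrite !ffunE. Qed.

Lemma args_normal_uapp : args_normal (Useq X) (uapp u w sigma) ->
  normal_form U w.
Proof. by move/(_ ord0); rewrite -/a a0. Qed.

End Uapp.

(** Brings an arbitrary U-node into the scope of [good_uappP]; since [X u] has no repetitions, each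
    stored argument is the value of its own variable. *)
Lemma uargs_eta u (a : {ffun 'I_(uar X (inr u)) -> uterms}) :
  a = uargs u (a ord0) (fun x => a (binding_pos u x)).
Proof.
have uX : uniq (X u) by case: u a => alpha i a; have [] := hX i.
apply/ffunP=> -[[|j] ltj]; rewrite ffunE /=.
  by congr (a _); apply: val_inj.
rewrite (nth_map 0) //; congr (a _); apply: val_inj.
by rewrite /= binding_pos_val ?mem_nth // index_uniq.
Qed.

(** * Simulation of innermost steps *)

Lemma lhs_not_Var w : normal_form U w ->
  forall (alpha : R) y, lhs (val alpha) <> Var y.
Proof.
(* [DCTRS] permits a variable as left-hand side, but the unraveling of such a rule would rewrite
   every term, [w] included. *)
move=> nfw alpha y lhsV; apply: nfw.
suff [r ur] : exists r, Useq X (Var y) r.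
  by exists (subst (fun=> w) r); apply: (rstep_root (fun=> w) ur).
have <- : lift_term X (lhs (val alpha)) = Var y by rewrite lhsV.
have [c0|cn0] := posnP (size (conds (val alpha))).
  by eexists; apply/Useq_uncond/size0nil.
by eexists; apply: (@Useq_first _ _ _ X alpha (Ordinal cn0)).
Qed.

(* The root steps taken here are innermost: [args_normal] is what makes the   *)
(* bindings stored by the new U-symbols normal forms.                         *)
Lemma good_root_step sigma l r :
  (forall (alpha : R) y, lhs (val alpha) <> Var y) ->
  Useq X l r -> good (subst sigma l) ->
  args_normal (Useq X) (subst sigma l) ->
  good (subst sigma r) /\
  rtc (cstep R) (back (subst sigma l)) (back (subst sigma r)).
Proof.
move=> lhsV; case=> [alpha c0|alpha i i0|alpha i j ji|alpha i iS].
- have Ra : R (val alpha) := set_mem (valP alpha).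
  move=> /good_subst_lift gl _; rewrite !back_lift; split.
    apply/good_subst_lift => x /(rhs_prefix (hdet Ra)).
    by rewrite c0 prefix_vars0; apply: gl.
  by apply/rt_step/cstep_root => //; rewrite c0.
(* Opening a rule: [back] restores the instance of l, and s_1 reaches itself in zero steps. *)
- move=> /good_subst_lift gl nfl; rewrite subst_uterm back_uapp back_lift.
  have Ra : R (val alpha) := set_mem (valP alpha).
  split; last exact: rt_refl.
  have Xl : X (existT _ alpha i) =i vars (lhs (val alpha)).
    by move=> x; rewrite mem_X /upos /= i0 prefix_vars0.
  apply/good_uappP; split.
  + apply/good_subst_lift => x xs; apply: gl; rewrite -Xl mem_X.
    exact: (hdet Ra).2 _ _ _ xs.
  + move=> x; rewrite Xl => xl; split; first exact: gl.
    apply: (args_normal_subst (lift_Var (lhsV alpha)) nfl).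
    by rewrite vars_lift.
  + by rewrite /upos /= i0.
  + rewrite back_lift; exact: rt_refl.
(* Next condition: matching t_i turns the running reduction from s_i into a satisfied condition. The
   new bindings are subterms of the normal argument 0. *)
- rewrite !subst_uterm !back_uapp => /good_uappP[gt gX hc hs].
  move=> /args_normal_uapp nft; split; last exact: rt_refl.
  have Ra : R (val alpha) := set_mem (valP alpha).
  have gnf x : x \in X (existT _ alpha j) ->
      good (sigma x) /\ normal_form U (sigma x).
    rewrite mem_X /upos /= ji prefix_varsS ?ltn_ord // mem_cat.
    have := gX x; rewrite mem_X => gXx /orP[/gXx//|xt].
    split; first exact: (good_subst_lift _ _).1 gt _ xt.
    by apply: (normal_form_subst nft); rewrite vars_lift.
  apply/good_uappP; split=> //.
  + apply/good_subst_lift => x xs; apply: (gnf x _).1; rewrite mem_X.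
    exact: (hdet Ra).2 _ _ _ xs.
  + move=> m; rewrite /upos /= ji ltnS leq_eqVlt => /orP[/eqP->|/hc//].
    by move: hs; rewrite back_lift.
  + rewrite back_lift; exact: rt_refl.
(* Closing a rule: the earlier conditions are recorded in [hc] and the last one in [hs], so the rule
   fires in R. *)
- rewrite subst_uterm back_uapp back_lift => /good_uappP[gt gX hc hs] _.
  have Ra : R (val alpha) := set_mem (valP alpha).
  split.
    apply/good_subst_lift => x /(rhs_prefix (hdet Ra)).
    rewrite -iS prefix_varsS ?ltn_ord // mem_cat => /orP[xX|].
      by apply: (gX x _).1; rewrite mem_X.
    exact: (good_subst_lift _ _).1 gt x.
  apply/rt_step/cstep_root => // m.
  rewrite -iS ltnS leq_eqVlt => /orP[/eqP->|/hc//].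
  by move: hs; rewrite back_lift.
Qed.

Lemma good_progress w :
  (forall (alpha : R) y, lhs (val alpha) <> Var y) ->
  good w -> ~ normal_form U w ->
  exists w', [/\ U w w', good w' & rtc (cstep R) (back w) (back w')].
Proof.
move=> lhsV; elim/term_nested_ind: w => [x|g a IH] gw.
  move=> /contrapT[w' Uw]; have [sigma [l [r [lr el er]]]] :=
    rstep_args_normal (S := Useq X) (t := Var x) I Uw.
  rewrite el in gw *; have [] := good_root_step lhsV lr gw.
    by rewrite -el.
  by exists (subst sigma r); split=> //; apply: rstep_root.
have [nfa|/existsNP[i nnf]] := pselect (forall i, normal_form U (a i)).
  move=> /contrapT[w' Uw]; have [sigma [l [r [lr el er]]]] :=
    rstep_args_normal (S := Useq X) (t := Fun g a) nfa Uw.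
  rewrite el in gw *; have [] := good_root_step lhsV lr gw.
    by rewrite -el.
  by exists (subst sigma r); split=> //; apply: rstep_root.
move=> _; have [t [Uat gt bt]] := IH i (gw.1 i) nnf.
exists (Fun g [ffun j => if j == i then t else a j]).
suff [gt' bt'] : good (Fun g [ffun j => if j == i then t else a j]) /\
    rtc (cstep R) (back (Fun g a))
      (back (Fun g [ffun j => if j == i then t else a j])).
  by split=> //; apply: rstep_arg.
case: g a {IH} gw i nnf {Uat}bt => [f|u] a gw i nnf bt.
  split; first by split=> // j; rewrite ffunE; case: eqP => // _; apply: gw.1.
  rewrite /=; set b := finfun _.
  have -> : finfun (fun j => back ([ffun j => if j == i then t else a j] j)) =
            [ffun j => if j == i then back t else b j].
    by apply/ffunP=> j; rewrite !ffunE; case: (j == i).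
  by apply: rtc_cstep_arg; rewrite ffunE.
(* Under a U-symbol the bindings are normal, so only argument 0 can be reducible. *)
have i0 : i = ord0.
  apply: contrapT => /eqP ni0; case: gw => _ [nfa _ _].
  by apply: nnf; apply: nfa.
rewrite {i nnf}i0 in bt *.
have [sigma ea] : exists sigma, a = uargs u (a ord0) sigma.
  by eexists; apply: uargs_eta.
move: (a ord0) ea bt gw => w -> bt /good_uappP[gw gX hc hs].
(* [back] ignores argument 0, so the image is unchanged; the step [bt] only prolongs the recorded
   reduction from the current s_i. *)
rewrite uargs_set_ord0 !back_uapp; split; last exact: rt_refl.
by apply/good_uappP; split=> //; apply: rt_trans bt.
Qed.

End Translation.

Theorem theorem18 (F : Type) (ar : F -> nat) (R : set (rule ar))
  (X : usym R -> seq nat) (hX : is_ordering X)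
  (hdet : DCTRS R) (hstable : right_stable R)
  (hconf : confluent (rstep (Useq X)))
  (hterm : terminating (rstep (Useq X))) :
  forall u v : term ar,
    clos_refl_trans (term (uar X)) (rstep (Useq X))
      (lift_term X u) (lift_term X v) ->
    normal_form (rstep (Useq X)) (lift_term X v) ->
    clos_refl_trans (term ar) (cstep R) u v.
Proof.
move=> u v uv nfv.
have lhsV := lhs_not_Var nfv.
pose P (w : term (uar X)) := good w /\ rtc (cstep R) u (back w).
have step w : P w -> ~ normal_form (rstep (Useq X)) w ->
    exists2 w', rstep (Useq X) w w' & P w'.
  move=> [gw uw] nnf.
  have [w' [ww' gw' bw]] := good_progress hX hdet lhsV gw nnf.
  by exists w' => //; split=> //; apply: rt_trans bw.
have Pu : P (lift_term X u).
  by split; [apply: good_lift | rewrite lift_termK; apply: rt_refl].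
have [w [_ uw] [luw nfw]] := terminating_progress hterm step Pu.
(* Both [w] and the lifted [v] are normal, so their common reduct equals each of them. *)
have [z [vz wz]] := hconf _ _ _ uv luw.
have zv := normal_form_rtc nfv vz; have zw := normal_form_rtc nfw wz.
by rewrite -zw zv lift_termK in uw.
Qed.
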